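(* Let $I\subset R=k[x_0,\dots,x_n]$ be the ideal of at most $n+1$ general fat points in $\mathbb P^n$. Then $I$ is componentwise linear.
   Context: $k$ is a field and $R=k[x_0,\dots,x_n]$ is the homogeneous coordinate ring of $\mathbb P^n$. A set of at most $n+1$ general fat points consists of $r+1\le n+1$ points $P_0,\dots,P_r\in\mathbb P^n$ in general position (linearly independent) with positive integer multiplicities $a_0\ge a_1\ge\cdots\ge a_r$. After a linear change of coordinates one takes $P_i=[0:\cdots:0:1:0:\cdots:0]$ with the $1$ in the position of $x_i$; letting $\mathfrak p_i=(x_0,\dots,x_{i-1},x_{i+1},\dots,x_n)$, the ideal of the set of fat points is $I=\mathfrak p_0^{a_0}\cap\cdots\cap\mathfrak p_r^{a_r}$. For a homogeneous ideal $J\subset R$, $J_{<d>}$ denotes the ideal generated by all homogeneous elements of degree $d$ in $J$. $J$ is componentwise linear if for every $d$ the ideal $J_{<d>}$ has a $d$-linear resolution, i.e. its generators are only in degree $d$, its minimal first syzygies only in degree $d+1$, and in general its minimal $i$-th syzygies only in degree $d+i$ (the zero ideal is regarded as having a linear resolution). *)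

(* Defs.v *)
From mathcomp Require Import all_boot all_order all_algebra.
From mathcomp Require Export mpoly.

Set Implicit Arguments.
Unset Strict Implicit.
Unset Printing Implicit Defensive.

Import GRing.Theory.
Local Open Scope ring_scope.

Section Ideals.
Variable R : comNzRingType.
Implicit Types (I : R -> Prop) (f : R).

Definition is_ideal I : Prop :=
  [/\ I 0, (forall f g, I f -> I g -> I (f + g))
         & (forall f g, I g -> I (f * g))].

Definition ideal_gen (S : R -> Prop) f : Prop :=
  exists m (c g : 'I_m -> R),
    (forall i, S (g i)) /\ f = \sum_(i < m) c i * g i.

Definition ideal_pow I (a : nat) : R -> Prop :=
  ideal_gen (fun f => exists g : 'I_a -> R,
    (forall i, I (g i)) /\ f = \prod_(i < a) g i).

End Ideals.

Section GradedIdeals.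
Variables (k : fieldType) (n : nat).
Local Notation R := {mpoly k[n]}.
Implicit Types (J : R -> Prop) (f : R) (d : nat).

Definition is_homogeneous_ideal J : Prop :=
  is_ideal J /\ forall f d, J f -> J (pihomog mdeg d f).

Definition degree_part_ideal J d : R -> Prop :=
  ideal_gen (fun f => J f /\ f \is d.-homog).

(* Data of a chain of graded free modules of finite rank augmented to R,
     ... -> F_1 -> F_0 -> R,   F_i = \bigoplus_s R(- gf_deg i s).
   Elements of F_i are row vectors and maps act by right multiplication.
   Twists are natural numbers, which suffices for minimal resolutions of
   ideals of R. *)
Record graded_free_chain := GradedFreeChain {
  gf_rank : nat -> nat;
  gf_deg : forall i, 'I_(gf_rank i) -> nat;
  gf_aug : 'cV[R]_(gf_rank 0);
  gf_diff : forall i, 'M[R]_(gf_rank i.+1, gf_rank i)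
}.

(* f is homogeneous of degree e - s; there are no nonzero elements of
   negative degree. *)
Definition homog_shift (e s : nat) f : Prop :=
  if (s <= e)%N then is_true (f \is (e - s).-homog) else f = 0.

Definition is_graded (F : graded_free_chain) : Prop :=
  (forall s, gf_aug F s 0 \is (gf_deg s).-homog) /\
  (forall i s t, homog_shift (@gf_deg F i.+1 s) (@gf_deg F i t)
                             (gf_diff F i s t)).

Definition resolves (F : graded_free_chain) J : Prop :=
  [/\ (forall f, J f <-> exists v, v *m gf_aug F = f%:M),
      (forall v, v *m gf_aug F = 0 <->
         exists w : 'rV_(gf_rank F 1), v = w *m gf_diff F 0)
    & (forall i (v : 'rV_(gf_rank F i.+1)), v *m gf_diff F i = 0 <->
         exists w : 'rV_(gf_rank F i.+2), v = w *m gf_diff F i.+1)].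

(* Every differential maps F_(i+1) into (x_0, ..., x_(n-1)) F_i. *)
Definition is_minimal (F : graded_free_chain) : Prop :=
  forall i s t, (gf_diff F i s t)@_0%MM = 0.

Definition minimal_graded_free_resolution (F : graded_free_chain) J : Prop :=
  [/\ is_graded F, resolves F J & is_minimal F].

(* Minimal graded free resolutions are unique up to isomorphism, so the
   degrees do not depend on F. For J = 0 the only F has all ranks 0. *)
Definition has_linear_resolution d J : Prop :=
  exists F, minimal_graded_free_resolution F J /\
            forall i (s : 'I_(gf_rank F i)), gf_deg s = (d + i)%N.

Definition componentwise_linear J : Prop :=
  is_homogeneous_ideal J /\
  forall d, has_linear_resolution d (degree_part_ideal J d).

End GradedIdeals.

Section FatPoints.
Variables (k : fieldType) (n : nat).

(* Homogeneous ideal of the point of P^n with homogeneous coordinates p;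
   for the i-th coordinate point it is (x_j | j != i). *)
Definition point_ideal (p : 'rV[k]_n.+1) : {mpoly k[n.+1]} -> Prop :=
  ideal_gen (fun f => (exists d, f \is d.-homog) /\ f.@[fun j => p 0 j] = 0).

(* Row i of P holds homogeneous coordinates of the i-th point. *)
Definition fat_points_ideal m (P : 'M[k]_(m, n.+1)) (a : 'I_m -> nat) :
    {mpoly k[n.+1]} -> Prop :=
  fun f => forall i, ideal_pow (point_ideal (row i P)) (a i) f.

End FatPoints.

(* Main.v *)
From HB Require Import structures.
Require Import Defs.
From mathcomp Require Import all_boot all_order all_algebra.
From mathcomp Require Import mpoly zify.

(** A linear change of coordinates, which is a graded automorphism of the
    polynomial ring, moves the linearly independent points to coordinate points
    ([row_free_completion], [componentwise_linear_automorphism]).  There the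
    ideal I of the fat points is spanned as a vector space by the monomials x^m
    with a_i <= |m| - m_i for every i ([point_ideal_pow_coordinate]).  Hence the
    ideal generated by the degree-d part of I is of Veronese type: its generators
    are all monomials of degree d whose exponents satisfy m_i <= d - a_i.

    Such an ideal has linear quotients.  List the generators from the
    lexicographically largest to the smallest, and let u be one of them.  The
    colon ideal of the larger generators by u is generated by the variables x_i
    with u_i < d - a_i for which u involves some x_j with j > i: for these,
    x_i u / x_j is a larger generator, and a larger generator w, first differing
    from u at i, satisfies w_i > u_i, so that x_i divides w / gcd(u, w)
    ([fat_generators_colon]).

    Ideals with linear quotients have linear resolutions.  Adding a generator u
    of degree d to an ideal extends R/(some variables)(-d), which has a linear
    resolution, by the ideal, and an extension of modules with linear resolutions
    has one, by the horseshoe construction ([linear_syzygies_extension]).  The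
    Koszul case is covered by the same induction: distinct variables have linear
    quotients, the successive colon ideals being generated by the previous
    variables.  A resolution all of whose differentials have linear entries is
    automatically minimal, so no cancellation is needed at the end
    ([linear_resolution_of_syzygies]). *)

Set Implicit Arguments.
Unset Strict Implicit.
Unset Printing Implicit Defensive.

Import Order.TTheory GRing.Theory.
Local Open Scope ring_scope.

(** * Linear resolutions and extensions *)

Section LinearResolutions.
Variables (k : fieldType) (n : nat).
Local Notation R := {mpoly k[n]}.

Definition homog_mx e p q (A : 'M[R]_(p, q)) : Prop :=
  forall i j, A i j \is e.-homog.

(** [K] stands for the first syzygies of a module presented by [p] generators of
    one degree; it is cut into finitely many steps because linear resolutions
    over a polynomial ring are finite, which makes induction on the length [l]
    available.  [K] is a predicate rather than a matrix kernel so that it can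
    also be a colon ideal, seen in rank one. *)
Fixpoint linear_syzygies (l : nat) p (K : 'rV[R]_p -> Prop) : Prop :=
  match l with
  | 0 => forall v, K v <-> v = 0
  | l.+1 => exists q (B : 'M[R]_(q, p)),
      [/\ homog_mx 1 B, forall v, K v <-> exists w, v = w *m B
        & linear_syzygies l (fun w => w *m B = 0)]
  end.

Lemma linear_syzygies_ext l p (K K' : 'rV[R]_p -> Prop) :
  (forall v, K v <-> K' v) -> linear_syzygies l K -> linear_syzygies l K'.
Proof.
move=> eqK; case: l => [|l] /=.
  by move=> K0 v; rewrite -eqK.
case=> q [B [homB spanB linB]]; exists q, B; split=> // v.
by rewrite -eqK.
Qed.

Lemma linear_syzygiesS l p (K : 'rV[R]_p -> Prop) :
  linear_syzygies l K -> linear_syzygies l.+1 K.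
Proof.
elim: l p K => [|l IHl] p K.
  move=> K0; exists 0, 0; split=> [[] // | v | w].
  - split=> [/K0 -> | [w ->]]; first by exists 0; rewrite mulmx0.
    by apply/K0; rewrite mulmx0.
  - by rewrite mulmx0; split=> // _; apply/matrixP=> ? [].
case=> q [B [homB spanB linB]]; exists q, B; split=> //.
exact: IHl.
Qed.

Lemma linear_syzygiesW l l' p (K : 'rV[R]_p -> Prop) : (l <= l')%N ->
  linear_syzygies l K -> linear_syzygies l' K.
Proof.
by move/subnK <-; elim: (l' - l)%N => // i IHi /IHi; apply: linear_syzygiesS.
Qed.

Lemma pihomog_mul_homog e d (f g : R) : g \is e.-homog ->
  pihomog mdeg (d + e)%N (f * g) = pihomog mdeg d f * g.
Proof.
move=> homg; rewrite [f in LHS](@pihomog_partitionE _ _ mdeg (maxn (msize f) d.+1));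
  last exact: leq_maxl.
have ltd: (d < maxn (msize f) d.+1)%N by rewrite leq_maxr.
rewrite mulr_suml raddf_sum (bigD1 (Ordinal ltd)) //= big1 ?addr0 => [|i nid].
  by rewrite pihomog_dE // dhomogM // pihomogP.
rewrite (@pihomog_ne0 _ _ _ (i + e)%N) // ?dhomogM ?pihomogP //.
by rewrite eqn_add2r; apply: contra nid => /eqP eid; apply/eqP/val_inj.
Qed.

Lemma pihomog_mulmx e d p q r (A : 'M[R]_(p, q)) (B : 'M[R]_(q, r)) :
  homog_mx e B ->
  map_mx (pihomog mdeg (d + e)%N) (A *m B) = map_mx (pihomog mdeg d) A *m B.
Proof.
move=> homB; apply/matrixP=> i j; rewrite !mxE raddf_sum.
by apply: eq_bigr => s _; rewrite mxE -(pihomog_mul_homog d _ (homB s j)).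
Qed.

Lemma homog_col_mx e p q r (A : 'M[R]_(p, r)) (B : 'M[R]_(q, r)) :
  homog_mx e A -> homog_mx e B -> homog_mx e (col_mx A B).
Proof. by move=> hA hB i j; rewrite mxE; case: splitP. Qed.

Lemma homog_row_mx e p q r (A : 'M[R]_(r, p)) (B : 'M[R]_(r, q)) :
  homog_mx e A -> homog_mx e B -> homog_mx e (row_mx A B).
Proof. by move=> hA hB i j; rewrite mxE; case: splitP. Qed.

Lemma homog_mx0 e p q : homog_mx e (0 : 'M[R]_(p, q)).
Proof. by move=> i j; rewrite mxE dhomog0. Qed.

(** Horseshoe construction.  The rows of [A'] generate a submodule N of the module
    M generated by the rows of [A] and [A'], and [K] is the module of relations of
    M / N.  Each linear relation in [K] lifts to a relation of M whose
    coefficients on [A'] can be cut down to their degree-one part, because [A] and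
    [A'] are homogeneous of the same degree.  The lifts [B | D] and the relations
    [0 | B'] of N then generate the relations of M, and they are again in the
    position of [A] and [A'], one step further in the resolution. *)
Lemma linear_syzygies_extension l e p q r (A : 'M[R]_(q, r)) (A' : 'M[R]_(p, r))
    (K : 'rV[R]_q -> Prop) :
  homog_mx e A -> homog_mx e A' ->
  linear_syzygies l (fun w => w *m A' = 0) -> linear_syzygies l K ->
  (forall w, K w <-> exists v, w *m A + v *m A' = 0) ->
  linear_syzygies l (fun w => w *m col_mx A A' = 0).
Proof.
elim: l p q r e A A' K => [|l IHl] p q r e A A' K homA homA'.
  move=> kerA' K0 defK v; rewrite -[v]hsubmxK mul_row_col.
  split=> [vA0 | ]; last first.
    by move/eqP; rewrite row_mx_eq0 => /andP[/eqP-> /eqP->]; rewrite !mul0mx addr0.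
  have v0: lsubmx v = 0 by apply/K0/defK; exists (rsubmx v).
  move: vA0; rewrite v0 mul0mx add0r => /kerA' ->.
  exact: row_mx0.
case=> q1 [B' [homB' spanB' linB']] [q2 [B [homB spanB linB]]] defK.
have [C rowC] : exists C : 'I_q2 -> 'rV[R]_p,
    forall i, row i B *m A + C i *m A' = 0.
  apply: (fin_all_exists (P := fun i C => row i B *m A + C *m A' = 0)) => i.
  by apply/defK/spanB; exists (delta_mx 0 i); rewrite rowE.
(* Degree-one parts of the lifts: B *m A and C *m A' cancel in each degree. *)
pose D : 'M[R]_(q2, p) := map_mx (pihomog mdeg 1) (\matrix_i C i).
have homD : homog_mx 1 D by move=> i j; rewrite mxE pihomogP.
have BD0 : B *m A + D *m A' = 0.
  have BC0 : B *m A + (\matrix_i C i) *m A' = 0.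
    by apply/row_matrixP=> i; rewrite linearD /= !row_mul rowK rowC row0.
  have {1}-> : B = map_mx (pihomog mdeg 1) B.
    by apply/matrixP=> i j; rewrite mxE pihomog_dE.
  rewrite /D -!(pihomog_mulmx _ _ homA) -(pihomog_mulmx _ _ homA') -map_mxD BC0.
  by apply/matrixP=> i j; rewrite !mxE raddf0.
exists (q2 + q1)%N, (col_mx (row_mx B D) (row_mx 0 B')); split.
- apply: homog_col_mx; apply: homog_row_mx => //; exact: homog_mx0.
- move=> v; split=> [|[w ->]]; last first.
    rewrite -mulmxA mul_col_mx !mul_row_col BD0 mul0mx add0r.
    have -> : B' *m A' = 0.
      apply/row_matrixP=> i; rewrite row_mul row0; apply/spanB'.
      by exists (delta_mx 0 i); rewrite rowE.
    by rewrite col_mx0 mulmx0.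
  rewrite -[v]hsubmxK mul_row_col => vA0.
  have /spanB[w wB] : K (lsubmx v) by apply/defK; exists (rsubmx v).
  have /spanB'[w' wB'] : (rsubmx v - w *m D) *m A' = 0.
    rewrite mulmxBl -mulmxA; move/eqP: BD0; rewrite addrC addr_eq0 => /eqP->.
    by rewrite mulmxN opprK mulmxA -wB addrC.
  exists (row_mx w w'); rewrite mul_row_col !mul_mx_row mulmx0 add_row_mx addr0.
  by rewrite -wB -wB' addrC subrK.
apply: (IHl _ _ _ 1 _ _ (fun w => w *m B = 0)) => //.
- exact: homog_row_mx.
- by apply: homog_row_mx => //; exact: homog_mx0.
- apply: linear_syzygies_ext linB' => w; rewrite mul_mx_row mulmx0.
  split=> [->|/eqP]; first exact: row_mx0.
  by rewrite row_mx_eq0 eqxx => /eqP.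
move=> w; split=> [wB0 | [v]].
  have /spanB'[v vB'] : w *m D *m A' = 0.
    rewrite -mulmxA; move/eqP: BD0; rewrite addrC addr_eq0 => /eqP->.
    by rewrite mulmxN mulmxA wB0 mul0mx oppr0.
  exists (- v); rewrite !mul_mx_row wB0 mulmx0 add_row_mx addr0 mulNmx -vB'.
  by rewrite subrr row_mx0.
rewrite !mul_mx_row mulmx0 add_row_mx addr0 => /eqP.
by rewrite row_mx_eq0 => /andP[/eqP].
Qed.

(** The rank of the free modules is carried by a function on all indices; the
    shift puts the given [p] in front, so that no transport along an equality of
    dimensions is needed. *)
Definition shifted_rank p (rk : nat -> nat) (i : nat) : nat :=
  if i is j.+1 then rk j else p.

Lemma linear_syzygies_chain l p (K : 'rV[R]_p -> Prop) : linear_syzygies l K ->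
  exists rk (D : forall i, 'M[R]_(rk i, shifted_rank p rk i)),
    [/\ forall i, homog_mx 1 (D i),
        forall v : 'rV_p, K v <-> exists w : 'rV_(rk 0), v = w *m D 0
      & forall i (v : 'rV_(rk i)), v *m D i = 0 <->
          exists w : 'rV_(rk i.+1), v = w *m D i.+1].
Proof.
elim: l p K => [|l IHl] p K.
  move=> K0; exists (fun=> 0), (fun=> 0); split=> [i j|v|i v].
  - by move=> ?; rewrite mxE dhomog0.
  - split=> [/K0 -> | [w ->]]; first by exists 0; rewrite mulmx0.
    by apply/K0; rewrite mulmx0.
  - rewrite mulmx0; split=> // _; exists 0; rewrite mulmx0.
    by apply/matrixP=> ? [].
case=> q [B [homB spanB /IHl[rk [D [homD spanD exD]]]]].
exists (shifted_rank q rk).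
exists (fun i => match i return
   'M[R]_(shifted_rank q rk i, shifted_rank p (shifted_rank q rk) i) with
   0 => B | i.+1 => D i end).
by split; case.
Qed.

(** The entries of the differentials, being homogeneous of degree one, have no
    constant term; this is minimality. *)
Lemma linear_resolution_of_syzygies l d p (U : 'cV[R]_p) (J : R -> Prop) :
  homog_mx d U -> linear_syzygies l (fun v => v *m U = 0) ->
  (forall f, J f <-> exists v, v *m U = f%:M) ->
  has_linear_resolution d J.
Proof.
move=> homU /linear_syzygies_chain[rk [D [homD spanD exD]]] defJ.
exists (@GradedFreeChain k n (shifted_rank p rk) (fun i _ => d + i)%N U D).
split=> //; split; first split=> [s|i s t] /=.
- by rewrite addn0.
- by rewrite /homog_shift leq_add2l leqnSn addnS subSnn; apply: homD.
- by split.
- move=> i s t /=; apply: dhomog_nemf_coeff (homD i s t) _.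
  by rewrite mf0.
Qed.

End LinearResolutions.

(** * Monomial ideals with linear quotients *)

Section MonomialIdeals.
Variables (k : fieldType) (n : nat).
Local Notation R := {mpoly k[n]}.
Implicit Types (m u : 'X_{1..n}) (s : seq 'X_{1..n}) (f g : R).

Definition supported (P : pred 'X_{1..n}) f : Prop := {in msupp f, forall m, P m}.

Lemma supported0 P : supported P 0.
Proof. by move=> m; rewrite msupp0. Qed.

Lemma supportedD P f g : supported P f -> supported P g -> supported P (f + g).
Proof.
by move=> Pf Pg m /msuppD_le; rewrite mem_cat => /orP[/Pf|/Pg].
Qed.

Lemma supportedM (P Q S : pred 'X_{1..n}) f g :
  (forall m1 m2, P m1 -> Q m2 -> S (m1 + m2)%MM) ->
  supported P f -> supported Q g -> supported S (f * g).
Proof.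
move=> PQS Pf Qg m /msuppM_le/allpairsP[[m1 m2] /= [/Pf P1 /Qg Q2 ->]].
exact: PQS.
Qed.

Lemma supportedX P m : supported P 'X_[m] <-> P m.
Proof.
split=> [|Pm m']; first by apply; rewrite msuppX mem_head.
by rewrite msuppX inE => /eqP->.
Qed.

Lemma supportedMX P u f :
  supported P (f * 'X_[u]) <-> supported (fun m => P (m + u)%MM) f.
Proof.
split=> Pf m.
  move=> mf; apply: Pf; rewrite (perm_mem (msuppMX f u)) addmC.
  exact: (map_f (fun m' => u + m')%MM).
rewrite (perm_mem (msuppMX f u)) => /mapP[m' /Pf P' ->].
by rewrite addmC.
Qed.

(** Every polynomial is the sum of its terms, so closure under sums reduces
    membership to scalar multiples of single monomials. *)
Lemma supported_ind (P : pred 'X_{1..n}) (J : R -> Prop) :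
  J 0 -> (forall f g, J f -> J g -> J (f + g)) ->
  (forall c m, P m -> J (c *: 'X_[m])) -> forall f, supported P f -> J f.
Proof.
move=> J0 JD JX f Pf; rewrite [f]mpolyE.
elim: {1 2}(msupp f) (fun m => Pf m) => [|m s IHs] Ps; first by rewrite big_nil.
rewrite big_cons; apply: JD; first by apply/JX/Ps/mem_head.
by apply: IHs => m' s'; apply: Ps; rewrite inE s' orbT.
Qed.

Fixpoint monomial_col s : 'cV[R]_(size s) :=
  match s with
  | [::] => 0
  | m :: s' => col_mx ('X_[m])%:M (monomial_col s')
  end.

Definition divided_by s m := has (fun u => (u <= m)%MM) s.

Lemma homog_monomial_col d s : (forall m, m \in s -> mdeg m = d) ->
  homog_mx d (monomial_col s).
Proof.
elim: s => [|m s IHs] degs; first by case.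
apply: (@homog_col_mx _ _ d 1 (size s) 1); last first.
  by apply: IHs => m' s'; apply: degs; rewrite inE s' orbT.
by move=> i j; rewrite !mxE !ord1 mulr1n dhomogX; apply/eqP/degs/mem_head.
Qed.

(** A polynomial lies in a monomial ideal exactly when each of its monomials is
    divisible by a generator; this turns all colon ideals below into
    combinatorics. *)
Lemma monomial_colP s f :
  (exists v, v *m monomial_col s = f%:M) <-> supported (divided_by s) f.
Proof.
split=> [[v] | ].
  elim: s v f => [|u s IHs] v f /=.
    rewrite mulmx0 => /matrixP/(_ 0 0); rewrite !mxE mulr1n => <-.
    exact: supported0.
  rewrite -[v](@hsubmxK _ 1 1 (size s)) (@mul_row_col _ _ 1).
  set a := lsubmx _; set w := rsubmx _ => def_f.
  have -> : f = a 0 0 * 'X_[u] + (w *m monomial_col s) 0 0.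
    by move/matrixP/(_ 0 0): def_f; rewrite mul_mx_scalar !mxE mulr1n mulrC.
  apply: supportedD.
    apply/supportedMX=> m _; apply/orP; left; exact: lem_addl.
  have Pw: supported (divided_by s) ((w *m monomial_col s) 0 0).
    by apply: (IHs w); apply: mx11_scalar.
  by move=> m /Pw Pm; apply/orP; right.
move: f; apply: supported_ind.
- by exists 0; rewrite mul0mx; apply/matrixP=> i j; rewrite !mxE mul0rn.
- by move=> f g [v vf] [w wg]; exists (v + w); rewrite mulmxDl vf wg raddfD.
move=> c m /hasP[u us um].
have [v vu] : exists v, v *m monomial_col s = ('X_[u])%:M.
  elim: s us => [//|u' s IHs]; rewrite inE => /orP[/eqP <- | /IHs[v vu]].
    by exists (row_mx 1%:M 0); rewrite (@mul_row_col _ _ 1) mul1mx mul0mx addr0.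
  by exists (@row_mx _ 1 1 _ 0 v); rewrite (@mul_row_col _ _ 1) mul0mx add0r.
exists ((c *: 'X_[m - u]) *: v); rewrite -scalemxAl vu scale_scalar_mx.
by rewrite -scalerAl -mpolyXD submK.
Qed.

Definition variables (t : seq 'I_n) : seq 'X_{1..n} := [seq U_(i)%MM | i <- t].

Lemma divided_by_variables t m :
  divided_by (variables t) m = has (fun i => 0 < m i)%N t.
Proof.
by rewrite /divided_by has_map; apply: eq_has => i; rewrite /= lep1mP lt0n.
Qed.

Definition has_linear_syzygies s : Prop :=
  exists l, linear_syzygies l (fun w => w *m monomial_col s = 0).

(** The relations of the new generator [u] modulo the ideal of [s] form the colon
    ideal of [s] by [u].  Since it is generated by variables, its generators are
    linear and their own syzygies are linear too. *)
Lemma linear_quotient_cons d u s t :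
  mdeg u = d -> (forall m, m \in s -> mdeg m = d) ->
  (forall m, divided_by s (m + u)%MM = has (fun i => 0 < m i)%N t) ->
  has_linear_syzygies (variables t) -> has_linear_syzygies s ->
  has_linear_syzygies (u :: s).
Proof.
move=> degu degs colon [l1 lin1] [l2 lin2]; exists (maxn l1.+1 l2).
have homu : homog_mx d (('X_[u])%:M : 'M[R]_1).
  by move=> i j; rewrite !mxE !ord1 mulr1n dhomogX; apply/eqP.
have homs := homog_monomial_col degs.
pose K (w : 'rV[R]_1) := exists v, w = v *m monomial_col (variables t).
apply: (@linear_syzygies_extension _ _ _ d _ _ _ _ _ K) => //.
- exact: linear_syzygiesW (leq_maxr _ _) lin2.
- apply: (linear_syzygiesW (leq_maxl _ _)).
  exists _, (monomial_col (variables t)); split=> //.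
  by apply: homog_monomial_col => _ /mapP[i _ ->]; rewrite mdeg1.
move=> w; rewrite [w]mx11_scalar; set g := w 0 0.
have -> : K g%:M <-> supported (divided_by (variables t)) g.
  by rewrite -monomial_colP; split=> -[v]; exists v.
have -> : (exists v, g%:M *m ('X_[u])%:M + v *m monomial_col s = 0) <->
          supported (divided_by s) (g * 'X_[u]).
  rewrite -monomial_colP -scalar_mxM; split=> -[v].
    by move/eqP; rewrite addrC addr_eq0 => /eqP vu; exists (- v); rewrite mulNmx vu opprK.
  by move=> vu; exists (- v); rewrite mulNmx vu subrr.
rewrite supportedMX; split=> Pg m /Pg; rewrite divided_by_variables colon //.
Qed.

Lemma has_linear_syzygies_nil : has_linear_syzygies [::].
Proof.
exists 0%N => v; rewrite mulmx0; split=> // _.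
by apply/matrixP=> ? [].
Qed.

(** This replaces the Koszul complex: a variable is a nonzerodivisor modulo other
    variables, so each colon ideal is generated by the other variables in the
    list. *)
Lemma has_linear_syzygies_variables t : uniq t -> has_linear_syzygies (variables t).
Proof.
elim: t => [|i t IHt] /=; first by move=> _; apply: has_linear_syzygies_nil.
case/andP=> it /IHt{}IHt; apply: (@linear_quotient_cons 1 _ _ t) => //.
- exact: mdeg1.
- by move=> _ /mapP[j _ ->]; rewrite mdeg1.
move=> m; rewrite divided_by_variables; apply: eq_in_has => j jt /=.
rewrite mnmDE mnm1E; case: eqP => [ij|_]; last by rewrite addn0.
by rewrite ij jt in it.
Qed.

Lemma linear_quotients_linear_syzygies d s :
  (forall m, m \in s -> mdeg m = d) ->
  (forall s1 u s2, s = s1 ++ u :: s2 -> exists2 t, uniq t &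
     forall m, divided_by s2 (m + u)%MM = has (fun i => 0 < m i)%N t) ->
  has_linear_syzygies s.
Proof.
elim: s => [|u s IHs] degs colon; first exact: has_linear_syzygies_nil.
have [t uniqt colon_u] := colon [::] u s erefl.
have degs' m : m \in s -> mdeg m = d.
  by move=> ms; apply: degs; rewrite inE ms orbT.
apply: (@linear_quotient_cons d _ _ t) => //.
- exact/degs/mem_head.
- exact: has_linear_syzygies_variables.
apply: IHs => // s1 v s2 def_s; apply: (colon (u :: s1)).
by rewrite def_s.
Qed.

End MonomialIdeals.

(** * Ideals of Veronese type *)

Section IdealGeneration.
Variable R : comNzRingType.
Implicit Types (S : R -> Prop) (f g : R).

Lemma ideal_gen_mem S f : S f -> ideal_gen S f.
Proof.
move=> Sf; exists 1%N, (fun=> 1), (fun=> f).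
by rewrite big_ord1 mul1r.
Qed.

Lemma ideal_gen_is_ideal S : is_ideal (ideal_gen S).
Proof.
split=> [|f g [p [c [u [Su ->]]]] [q [d [v [Sv ->]]]]|f g [p [c [u [Su ->]]]]].
- by exists 0%N, (fun=> 0), (fun=> 0); rewrite big_ord0; split=> // -[].
- pose join A (x : 'I_p -> A) y (i : 'I_(p + q)) :=
    match split i with inl j => x j | inr j => y j end.
  exists (p + q)%N, (join _ c d), (join _ u v); split=> [i|].
    by rewrite /join; case: (split i).
  rewrite big_split_ord; congr (_ + _); apply: eq_bigr => i _; rewrite /join.
    by rewrite (unsplitK (inl i)).
  by rewrite (unsplitK (inr i)).
- exists p, (fun i => f * c i), u; split=> //.
  by rewrite mulr_sumr; apply: eq_bigr => i _; rewrite mulrA.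
Qed.

End IdealGeneration.

Section VeroneseType.
Variables (k : fieldType) (n : nat).
Local Notation R := {mpoly k[n]}.
Implicit Types (m u w : 'X_{1..n}) (f g : R) (a : 'I_n -> nat).

(** The order of vanishing of the monomial at the [i]-th coordinate point. *)
Definition codeg (i : 'I_n) m : nat := (mdeg m - m i)%N.

Lemma codegE i m : codeg i m = (\sum_(j | j != i) m j)%N.
Proof. by rewrite /codeg mdegE (bigD1 i) //= addKn. Qed.

Lemma codegD i m1 m2 : codeg i (m1 + m2)%MM = (codeg i m1 + codeg i m2)%N.
Proof.
by rewrite !codegE -big_split; apply: eq_bigr => j _; rewrite mnmDE.
Qed.

Lemma leq_mdeg m i : (m i <= mdeg m)%N.
Proof. by rewrite mdegE (bigD1 i) //= leq_addr. Qed.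

Definition fat_monomial a m : bool := [forall i, (a i <= codeg i m)%N].

Lemma fat_monomialD a m1 m2 : fat_monomial a m2 -> fat_monomial a (m1 + m2)%MM.
Proof.
move/forallP=> am; apply/forallP=> i; rewrite codegD.
exact: leq_trans (am i) (leq_addl _ _).
Qed.

(** The increasing order puts each generator in front of the lexicographically
    larger ones, matching lists that grow at the head. *)
Definition fat_generators a d : seq 'X_{1..n} :=
  sort <=%O [seq m <- [seq val b | b <- enum {: 'X_{1..n < d.+1}}]
             | (mdeg m == d) && fat_monomial a m].

Lemma mem_fat_generators a d m :
  (m \in fat_generators a d) = (mdeg m == d) && fat_monomial a m.
Proof.
rewrite mem_sort mem_filter andbC; apply: andb_idl => /andP[/eqP degm _].
have ltm: (mdeg m < d.+1)%N by rewrite degm.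
by apply/mapP; exists (BMultinom ltm); rewrite ?mem_enum.
Qed.

Lemma fat_generators_sorted a d : sorted <%O (fat_generators a d).
Proof.
rewrite sort_lt_sorted filter_uniq // map_inj_uniq ?enum_uniq //.
exact: val_inj.
Qed.

Lemma exchange_exists u w (i : 'I_n) : mdeg u = mdeg w ->
  (forall j : 'I_n, (j < i)%N -> u j = w j) -> (u i < w i)%N ->
  exists2 j : 'I_n, (i < j)%N & (w j < u j)%N.
Proof.
move=> eqdeg eqlt lti; apply/exists_inP; apply: contraTT isT.
rewrite negb_exists_in => /forall_inP gej; move/eqP: eqdeg.
rewrite !mdegE (bigD1 i) // [X in _ == X](bigD1 i) //= ltn_eqF //.
rewrite -addSn leq_add // leq_sum // => j neji.
have [ltij|ltji|/val_inj eqij] := ltngtP i j.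
- by rewrite leqNgt gej.
- by rewrite eqlt.
by rewrite eqij eqxx in neji.
Qed.

(** With [u] fixed, the variables x_i of the colon ideal are those for which some
    exchange x_i u / x_j with j > i respects all the bounds. *)
Lemma fat_generators_colon a d s1 u s2 : fat_generators a d = s1 ++ u :: s2 ->
  exists2 t, uniq t &
    forall m, divided_by s2 (m + u)%MM = has (fun i => 0 < m i)%N t.
Proof.
move=> defG; have := fat_generators_sorted a d.
rewrite (sorted_pairwise lt_trans) defG pairwise_cat /=.
case/and3P=> lt12 _ /andP[ltu _].
have memG w : (w \in s1 ++ u :: s2) = (mdeg w == d) && fat_monomial a w.
  by rewrite -defG mem_fat_generators.
have /andP[/eqP degu /forallP fatu] : (mdeg u == d) && fat_monomial a u.
  by rewrite -memG mem_cat mem_head orbT.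
exists [seq i <- enum 'I_n | (a i < codeg i u)%N &&
                             [exists j : 'I_n, (i < j)%N && (0 < u j)%N]].
  by rewrite filter_uniq // enum_uniq.
move=> m; apply/hasP/hasP=> -[].
  (* The first index where w exceeds u gives the variable; the degrees being
     equal, u exceeds w at some later index. *)
  move=> w ws2 /mnm_lepP lewm.
  have /andP[/eqP degw /forallP fatw] : (mdeg w == d) && fat_monomial a w.
    by rewrite -memG mem_cat inE ws2 !orbT.
  have eqdeg : mdeg u = mdeg w by rewrite degu degw.
  have /(ltmcP eqdeg)[i eqlt lti] := allP ltu _ ws2.
  exists i; last by have := lewm i; rewrite mnmDE; lia.
  rewrite mem_filter mem_enum andbT.
  have [j ltij ltj] := exchange_exists eqdeg eqlt lti.
  apply/andP; split; last by apply/existsP; exists j; rewrite ltij; lia.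
  have := fatw i; have := leq_mdeg w i; rewrite /codeg eqdeg; lia.
move=> i; rewrite mem_filter => /andP[/andP[lta /existsP[j /andP[ltij u0]]] _] m0.
(* Conversely, the exchanged monomial is the larger generator. *)
pose w := (u - U_(j) + U_(i))%MM.
have wE l : w l = (u l - (j == l) + (i == l))%N by rewrite mnmDE mnmBE !mnm1E.
have degw : mdeg w = mdeg u.
  have leju : (U_(j) <= u)%MM by rewrite lep1mP -lt0n.
  by rewrite -[in RHS](submK leju) !mdegD !mdeg1.
have neij : (j == i) = false by apply/negP=> /eqP eqji; rewrite eqji ltnn in ltij.
have ltuw : (u < w)%O.
  apply/ltmcP; first exact/esym.
  exists i => [l ltl|]; rewrite wE; last by rewrite neij eqxx; lia.
  have -> : (j == l) = false by apply/negP=> /eqP eqjl; rewrite eqjl in ltij; lia.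
  have -> : (i == l) = false by apply/negP=> /eqP eqil; rewrite eqil in ltl; lia.
  by rewrite subn0 addn0.
exists w.
  have : w \in s1 ++ u :: s2.
    rewrite memG degw degu eqxx; apply/forallP=> l; move: (fatu l).
    rewrite /codeg degw wE; case: (i =P l) => [<-|_]; last by lia.
    by move=> _; move: lta; rewrite neij /codeg; lia.
  rewrite mem_cat inE => /or3P[ws1|/eqP eqwu|//].
  - have /allrelP/(_ w u ws1 (mem_head _ _)) ltwu := lt12.
    by have := lt_trans ltuw ltwu; rewrite ltxx.
  - by rewrite eqwu ltxx in ltuw.
apply/mnm_lepP=> l; rewrite wE mnmDE.
by case: (i =P l) => [<-|_]; lia.
Qed.

Lemma supported_is_homogeneous_ideal (P : pred 'X_{1..n}) :
  (forall m1 m2, P m2 -> P (m1 + m2)%MM) -> is_homogeneous_ideal (supported (k:=k) P).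
Proof.
move=> PD; split.
  split=> [|f g|f g Pg]; [exact: supported0 | exact: supportedD |].
  apply: (@supportedM _ _ predT P) => // m1 m2 _; exact: PD.
move=> f d Pf m; rewrite mcoeff_msupp => nz; apply: Pf; rewrite mcoeff_msupp.
apply: contra nz => /eqP f0.
rewrite pihomogE raddf_sum big1_seq //= => u /andP[_ uf].
rewrite mcoeffZ mcoeffX; case: eqP => [eum|_]; last by rewrite mulr0.
by rewrite eum f0 mul0r.
Qed.

Lemma degree_part_fat a d f :
  degree_part_ideal (supported (fat_monomial a)) d f <->
  supported (divided_by (fat_generators a d)) f.
Proof.
split=> [[p [c [g [Sg ->]]]] | ].
  apply: big_ind => [||i _]; [exact: supported0 | exact: supportedD |].
  have [fatg homg] := Sg i.
  apply: (@supportedM _ _ predT (mem (fat_generators a d)) _ (c i)) =>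
    [m1 u _ uG||u ug] //.
    by apply/hasP; exists u; rewrite ?lem_addl.
  by rewrite /= mem_fat_generators fatg // andbT; apply/eqP/(dhomog_mf homg).
have [J0 JD JM] := ideal_gen_is_ideal
  (fun f => supported (fat_monomial a) f /\ f \is d.-homog).
move: f; apply: supported_ind => // c m /hasP[u uG um].
have -> : c *: 'X_[m] = (c *: 'X_[m - u]) * 'X_[u] :> R.
  by rewrite -scalerAl -mpolyXD submK.
move: uG; rewrite mem_fat_generators => /andP[degu fatu].
apply/JM/ideal_gen_mem; split; first exact/supportedX.
by rewrite dhomogX.
Qed.

Lemma fat_monomials_componentwise_linear a :
  componentwise_linear (supported (k:=k) (fat_monomial a)).
Proof.
split; first by apply: supported_is_homogeneous_ideal; exact: fat_monomialD.
move=> d; have degG m : m \in fat_generators a d -> mdeg m = d.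
  by rewrite mem_fat_generators => /andP[/eqP].
have [l lin] := linear_quotients_linear_syzygies k degG
  (@fat_generators_colon a d).
apply: (linear_resolution_of_syzygies (homog_monomial_col k degG) lin) => f.
by rewrite degree_part_fat -monomial_colP.
Qed.

End VeroneseType.

(** * Fat points at coordinate points *)

Section CoordinatePoints.
Variables (k : fieldType) (n : nat).
Local Notation R := {mpoly k[n.+1]}.
Implicit Types (m : 'X_{1..n.+1}) (f g : R) (i : 'I_n.+1).

Lemma ideal_gen_supported (P : pred 'X_{1..n.+1}) (S : R -> Prop) f :
  (forall m1 m2, P m2 -> P (m1 + m2)%MM) -> (forall g, S g -> supported P g) ->
  ideal_gen S f -> supported P f.
Proof.
move=> PD SP [p [c [g [Sg ->]]]].
apply: big_ind => [||j _]; [exact: supported0 | exact: supportedD |].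
by apply: (@supportedM _ _ predT P) (SP _ (Sg j)) => // m1 m2 _; exact: PD.
Qed.

Lemma codeg_upward i e m1 m2 : (e <= codeg i m2)%N -> (e <= codeg i (m1 + m2)%MM)%N.
Proof. by rewrite codegD => /leq_trans; apply; rewrite leq_addl. Qed.

Lemma meval_coordinate i m :
  'X_[m].@[fun j => (delta_mx 0 i : 'rV[k]_n.+1) 0 j] = (codeg i m == 0%N)%:R.
Proof.
rewrite mevalX codegE sum_nat_eq0; 
have [/forall_inP m0|] := boolP [forall (j | j != i), m j == 0%N].
  rewrite big1 // => j _; rewrite mxE eqxx /=; have [->|nij] := eqVneq j i.
    by rewrite expr1n.
  by rewrite (eqP (m0 j nij)).
rewrite negb_forall_in => /exists_inP[j nij mj].
by rewrite (bigD1 j) //= mxE (negbTE nij) expr0n (negbTE mj) mul0r.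
Qed.

(** The only monomial of degree d that does not vanish at the [i]-th coordinate
    point is x_i^d, so a form vanishes there exactly when x_i^d is missing
    from it. *)
Lemma point_ideal_coordinate i f :
  point_ideal (delta_mx 0 i) f <-> supported (fun m => 0 < codeg i m)%N f.
Proof.
split.
  apply: ideal_gen_supported => [m1 m2|g [[d homg] g0] m mg].
    exact: codeg_upward.
  rewrite lt0n; apply/negP=> m0; move: (mg); rewrite mcoeff_msupp => /eqP; apply.
  rewrite -[RHS]g0 [in RHS](mpolyE g) raddf_sum (bigD1_seq m) ?msupp_uniq //=.
  rewrite mevalZ meval_coordinate m0 mulr1 big1_seq ?addr0 // => u /andP[neum ug].
  rewrite mevalZ meval_coordinate; case: eqP => [u0|_]; last by rewrite mulr0.
  case/eqP: neum; apply/mnmP=> j.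
  have degE v : codeg i v = 0%N -> v i = mdeg v.
    by move=> v0; apply/eqP; rewrite eqn_leq leq_mdeg -subn_eq0 -/(codeg i v) v0.
  have offE v : codeg i v = 0%N -> j != i -> v j = 0%N.
    rewrite codegE => /eqP; rewrite sum_nat_eq0 => /forall_inP v0 /v0.
    by move/eqP.
  have [->|nij] := eqVneq j i; last by rewrite !offE //; apply/eqP.
  rewrite !degE //; last exact/eqP.
  by rewrite (dhomog_mf homg mg) (dhomog_mf homg ug).
have [J0 JD _] := ideal_gen_is_ideal
  (fun f => (exists d, f \is d.-homog) /\
            f.@[fun j => (delta_mx 0 i : 'rV[k]_n.+1) 0 j] = 0).
move: f; apply: supported_ind => // c m m0; apply: ideal_gen_mem.
rewrite mevalZ meval_coordinate -leqn0 leqNgt m0 mulr0; split=> //.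
by exists (mdeg m); rewrite dhomogZ // dhomogX.
Qed.

(** One variable other than x_i is split off at a time. *)
Lemma monomial_factorization i e m : (e <= codeg i m)%N ->
  exists h (g : 'I_e -> R),
    (forall j, point_ideal (delta_mx 0 i) (g j)) /\ 'X_[m] = h * \prod_(j < e) g j.
Proof.
elim: e m => [|e IHe] m lem.
  by exists 'X_[m], (fun=> 0); split=> [[] //|]; rewrite big_ord0 mulr1.
have [s nsi ms] : exists2 s, s != i & m s != 0%N.
  apply/exists_inP; apply: contraLR lem; rewrite negb_exists_in => /forall_inP m0.
  rewrite -ltnNge codegE big1 // => j /m0; rewrite negbK; exact: eqP.
have cod1 : codeg i U_(s)%MM = 1%N by rewrite /codeg mdeg1 mnm1E (negbTE nsi).
have leUm : (U_(s) <= m)%MM by rewrite lep1mP.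
have [|h [g [Ig def_m]]] := IHe (m - U_(s))%MM.
  by move: lem; rewrite -{1}(submK leUm) codegD cod1 addn1.
exists h, (fun j => if unlift ord0 j is Some j' then g j' else 'X_s); split=> [j|].
  case: unliftP => [j' _|_]; first exact: Ig.
  by apply/point_ideal_coordinate/supportedX; rewrite cod1.
rewrite big_ord_recl unlift_none -(submK leUm) mpolyXD def_m.
under [in RHS]eq_bigr do rewrite liftK.
by rewrite -mulrA [_ * 'X_s]mulrC.
Qed.

Lemma point_ideal_pow_coordinate i e f :
  ideal_pow (point_ideal (delta_mx 0 i)) e f <->
  supported (fun m => e <= codeg i m)%N f.
Proof.
split.
  apply: ideal_gen_supported => [m1 m2|_ [g [Ig ->]]]; first exact: codeg_upward.
  elim: e g Ig => [|e IHe] g Ig; first by move=> m.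
  rewrite big_ord_recl.
  apply: (@supportedM _ _ (fun m => 0 < codeg i m)%N (fun m => e <= codeg i m)%N).
  - by move=> m1 m2 /= ? ?; rewrite codegD -add1n leq_add.
  - exact/point_ideal_coordinate.
  - by apply: IHe => j; apply: Ig.
have [J0 JD JM] := ideal_gen_is_ideal (fun f => exists g : 'I_e -> R,
  (forall j, point_ideal (delta_mx 0 i) (g j)) /\ f = \prod_(j < e) g j).
move: f; apply: supported_ind => // c m /monomial_factorization[h [g [Ig ->]]].
by rewrite scalerAl; apply/JM/ideal_gen_mem; exists g.
Qed.

End CoordinatePoints.

(** * Changes of coordinates *)

Section GradedAutomorphisms.
Variables (k : fieldType) (n : nat).
Local Notation R := {mpoly k[n]}.
Implicit Types (f g : R) (J : R -> Prop).

Lemma has_linear_resolution_ext d J J' : (forall f, J f <-> J' f) ->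
  has_linear_resolution d J -> has_linear_resolution d J'.
Proof.
move=> eqJ [F [[grF [augF ex0 exF] minF] degF]]; exists F; split=> //.
by split=> //; split=> // f; rewrite -eqJ.
Qed.

Variables phi psi : {rmorphism R -> R}.
Hypotheses (phiK : cancel phi psi) (psiK : cancel psi phi).
Hypothesis phi_homog : forall d f, f \is d.-homog -> phi f \is d.-homog.
Hypothesis psi_homog : forall d f, f \is d.-homog -> psi f \is d.-homog.

Lemma ideal_gen_automorphism (S S' : R -> Prop) f : (forall g, S g <-> S' (phi g)) ->
  ideal_gen S f <-> ideal_gen S' (phi f).
Proof.
move=> SS'; split=> [[p [c [g [Sg ->]]]] | [p [c [g [Sg def_f]]]]].
  exists p, (phi \o c), (phi \o g); split=> [i|]; first exact/SS'/Sg.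
  by rewrite rmorph_sum; apply: eq_bigr => i _; rewrite rmorphM.
exists p, (psi \o c), (psi \o g); split=> [i|]; first by apply/SS'; rewrite /= psiK.
rewrite -[f]phiK def_f rmorph_sum; apply: eq_bigr => i _.
by rewrite rmorphM.
Qed.

Lemma ideal_pow_automorphism (J J' : R -> Prop) e f :
  (forall g, J g <-> J' (phi g)) -> ideal_pow J e f <-> ideal_pow J' e (phi f).
Proof.
move=> JJ'; apply: ideal_gen_automorphism => g; split=> -[h [Jh]].
  by move=> ->; exists (phi \o h); rewrite rmorph_prod; split=> // i; exact/JJ'.
move=> def_g; exists (psi \o h); rewrite -[g]phiK def_g rmorph_prod; split=> // i.
by apply/JJ'; rewrite /= psiK.
Qed.

Lemma homog_automorphism d f : (phi f \is d.-homog) = (f \is d.-homog).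
Proof. by apply/idP/idP => [/psi_homog|/phi_homog //]; rewrite phiK. Qed.

Lemma pihomog_automorphism d f : phi (pihomog mdeg d f) = pihomog mdeg d (phi f).
Proof.
rewrite [in RHS](@pihomog_partitionE _ _ mdeg (maxn (msize f) d.+1) f) ?leq_maxl //.
have ltd: (d < maxn (msize f) d.+1)%N by rewrite leq_maxr.
rewrite [X in _ = pihomog _ _ X]rmorph_sum [RHS]raddf_sum (bigD1 (Ordinal ltd)) //=.
rewrite [X in _ = _ + X]big1 ?addr0 => [|i nid].
  by rewrite [RHS]pihomog_dE //; apply: phi_homog; apply: pihomogP.
apply: (@pihomog_ne0 _ _ _ i); last by apply: phi_homog; apply: pihomogP.
by apply: contra nid => /eqP eid; apply/eqP/val_inj.
Qed.

(** Applying the inverse automorphism to the entries of all matrices keeps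
    exactness and degrees. *)
Lemma has_linear_resolution_automorphism d J :
  has_linear_resolution d J -> has_linear_resolution d (fun f => J (phi f)).
Proof.
have mapK p q : cancel (@map_mx _ _ phi p q) (map_mx psi).
  by move=> A; apply/matrixP=> i j; rewrite !mxE phiK.
have mapVK p q : cancel (@map_mx _ _ psi p q) (map_mx phi).
  by move=> A; apply/matrixP=> i j; rewrite !mxE psiK.
have exact_map p q r (v : 'rV[R]_q) (A : 'M_(q, r)) (B : 'M_(p, q)) :
    (forall v : 'rV_q, v *m A = 0 <-> exists w : 'rV_p, v = w *m B) ->
    v *m map_mx psi A = 0 <-> exists w : 'rV_p, v = w *m map_mx psi B.
  move=> exAB; split=> [vA0|[w ->]].
    have /exAB[w vwB] : map_mx phi v *m A = 0.
      by rewrite -[A]mapVK -map_mxM vA0 map_mx0.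
    by exists (map_mx psi w); rewrite -map_mxM -vwB mapK.
  rewrite -[w]mapK -!map_mxM.
  have /exAB -> : exists w', map_mx phi w *m B = w' *m B by exists (map_mx phi w).
  by rewrite map_mx0.
case=> -[rk deg aug diff] [[[homaug homdiff] [augF ex0 exF] minF] degF].
exists (GradedFreeChain deg (map_mx psi aug) (fun i => map_mx psi (diff i))).
split=> //; split; first split=> [s|i s t].
- by rewrite mxE psi_homog.
- move: (homdiff i s t); rewrite /homog_shift /= mxE.
  by case: ifP => _; [apply: psi_homog | move->; rewrite rmorph0].
- split=> [f|v|i v] /=; [|exact: exact_map|exact: exact_map].
  rewrite augF; split=> -[v] /= vf.
    by exists (map_mx psi v); rewrite -map_mxM vf map_scalar_mx /= phiK.
  by exists (map_mx phi v); rewrite -[aug]mapVK -map_mxM vf map_scalar_mx.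
- move=> i s t; rewrite mxE; move: (homdiff i s t) degF.
  rewrite /= /homog_shift => hom1 degF.
  move: hom1; rewrite !degF leq_add2l leqnSn addnS subSnn => hom1.
  by apply: dhomog_nemf_coeff (psi_homog hom1) _; rewrite mf0.
Qed.

Lemma componentwise_linear_automorphism J J' : (forall f, J' f <-> J (phi f)) ->
  componentwise_linear J -> componentwise_linear J'.
Proof.
move=> defJ' [[[J0 JD JM] Jhom] linJ]; split; first split=> [|f d /defJ' Jf].
- split=> [|f g /defJ' Jf /defJ' Jg|f g /defJ' Jg]; apply/defJ'.
  + by rewrite rmorph0.
  + by rewrite rmorphD; apply: JD.
  + by rewrite rmorphM; apply: JM.
- by apply/defJ'; rewrite pihomog_automorphism; apply: Jhom.
move=> d; apply: has_linear_resolution_ext (has_linear_resolution_automorphism (linJ d)).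
move=> f; apply: iff_sym; apply: ideal_gen_automorphism => g.
by rewrite homog_automorphism defJ'.
Qed.

End GradedAutomorphisms.

Section LinearSubstitutions.
Variables (k : fieldType) (n : nat).
Local Notation R := {mpoly k[n]}.
Implicit Types (Q : 'M[k]_n) (f : R).

(** Oriented so that evaluating the substituted polynomial at a row vector [p]
    is evaluating the original one at [p *m Q]; thus coordinate points are sent to
    the rows of [Q]. *)
Definition linear_subst Q : R -> R :=
  comp_mpoly [tuple \sum_(l < n) Q l j *: 'X_l | j < n].

HB.instance Definition _ Q := GRing.LRMorphism.on (linear_subst Q).

Lemma linear_substX Q j : linear_subst Q 'X_j = \sum_(l < n) Q l j *: 'X_l.
Proof. by rewrite /linear_subst comp_mpolyXU -tnth_nth tnth_mktuple. Qed.

Lemma meval_linear_subst Q (p : 'rV[k]_n) f :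
  (linear_subst Q f).@[fun j => p 0 j] = f.@[fun j => (p *m Q) 0 j].
Proof.
rewrite /linear_subst comp_mpoly_meval; apply: meval_eq => j.
rewrite tnth_mktuple raddf_sum mxE; apply: eq_bigr => l _.
by rewrite /= mevalZ mevalXU mulrC.
Qed.

Lemma linear_subst_homog Q d f : f \is d.-homog -> linear_subst Q f \is d.-homog.
Proof.
move=> /dhomogP homf; rewrite /linear_subst comp_mpolyEX big_seq.
apply: rpred_sum => m mf; apply: rpredZ; rewrite comp_mpolyX.
have -> : d = (\sum_(j < n) m j)%N by rewrite -mdegE; apply/esym/homf.
apply: (big_ind2 (fun (p : R) e => p \is e.-homog)) => [|p e q e' hp hq|j _].
- exact: dhomog1.
- exact: dhomogM.
rewrite tnth_mktuple -[X in X.-homog]mul1n; apply: dhomogMn.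
by apply: rpred_sum => l _; apply: rpredZ; rewrite dhomogX; apply/eqP; exact: mdeg1.
Qed.

Lemma linear_subst_comp Q Q' f :
  linear_subst Q (linear_subst Q' f) = linear_subst (Q *m Q') f.
Proof.
have : supported predT f by [].
move: f; apply: supported_ind => [|f g fE gE|c m _]; first by rewrite !rmorph0.
  by rewrite !rmorphD /= fE gE.
rewrite !linearZ; congr (_ *: _); rewrite mpolyXE_id /= !rmorph_prod /=.
apply: eq_bigr => j _; rewrite !rmorphXn /=; congr (_ ^+ _).
rewrite !linear_substX rmorph_sum /=.
rewrite (eq_bigr (fun l => \sum_(s < n) (Q s l * Q' l j) *: 'X_s)) => [|l _].
  rewrite exchange_big; apply: eq_bigr => s _.
  by rewrite mxE scaler_suml.
rewrite linearZ /= linear_substX scaler_sumr; apply: eq_bigr => s _.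
by rewrite scalerA mulrC.
Qed.

Lemma linear_subst1 f : linear_subst 1%:M f = f.
Proof.
rewrite -[RHS]comp_mpoly_id /linear_subst; congr comp_mpoly; apply: eq_from_tnth => j.
rewrite !tnth_mktuple (bigD1 j) //= big1 => [|l nlj]; rewrite !mxE.
  by rewrite eqxx scale1r addr0.
by rewrite (negbTE nlj) scale0r.
Qed.

End LinearSubstitutions.

(** Gaussian elimination writes [P] as L [1 0] U with L and U invertible; the
    completion is diag(L, 1) U. *)
Lemma row_free_completion (k : fieldType) p q (P : 'M[k]_(p, p + q)) :
  row_free P -> exists2 Q : 'M[k]_(p + q), Q \in unitmx & usubmx Q = P.
Proof.
move=> freeP; exists (block_mx (col_ebase P) 0 0 1%:M *m row_ebase P).
  rewrite unitmx_mul row_ebase_unit andbT unitmxE det_ublock det1 mulr1 -unitmxE.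
  exact: col_ebase_unit.
rewrite -[RHS]mulmx_ebase (eqP freeP) pid_mx_row.
rewrite /block_mx mul_col_mx col_mxKu mul_mx_row mulmx1 mulmx0.
by [].
Qed.

Theorem theorem4p6 (k : fieldType) (n r : nat) (hr : (r <= n)%N)
    (P : 'M[k]_(r.+1, n.+1)) (hP : row_free P)
    (a : 'I_r.+1 -> nat) (ha0 : forall i, (0 < a i)%N)
    (ha : forall i j : 'I_r.+1, (i <= j)%N -> (a j <= a i)%N) :
  componentwise_linear (fat_points_ideal P a).
Proof.
have [s def_n] : exists s, n = (r + s)%N by exists (n - r)%N; rewrite subnKC.
subst n; clear hr; have [Q unitQ defP] := @row_free_completion k r.+1 s P hP.
(* Multiplicity zero imposes no condition at the remaining coordinate points. *)
pose b (i : 'I_(r.+1 + s)) : nat := if split i is inl j then a j else 0%N.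
pose phi := linear_subst Q; pose psi := linear_subst (invmx Q).
have phiK : cancel phi psi.
  by move=> f; rewrite /phi /psi linear_subst_comp mulVmx // linear_subst1.
have psiK : cancel psi phi.
  by move=> f; rewrite /phi /psi linear_subst_comp mulmxV // linear_subst1.
have phi_homog := @linear_subst_homog k _ Q.
have psi_homog := @linear_subst_homog k _ (invmx Q).
have phi_point i f :
    point_ideal (row i Q) f <-> point_ideal (delta_mx 0 i) (phi f).
  apply: (ideal_gen_automorphism phiK psiK) => g.
  rewrite meval_linear_subst -rowE.
  by split=> -[[d homg] g0]; split=> //; exists d;
    rewrite (homog_automorphism phiK) in homg *.
apply: (componentwise_linear_automorphism phiK psiK phi_homog psi_homog)
  (fat_monomials_componentwise_linear k b) => f.
have coord i : ideal_pow (point_ideal (row i P)) (a i) f <->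
    supported (fun m => a i <= codeg (lshift s i) m)%N (phi f).
  rewrite -defP row_usubmx -point_ideal_pow_coordinate.
  exact: (ideal_pow_automorphism phiK psiK).
split=> [If m mf | If i].
  apply/forallP=> j; rewrite /b; case: splitP => // i ji.
  have -> : j = lshift s i by apply/val_inj.
  exact: (proj1 (coord i) (If i)).
apply/coord => m mf; move/forallP/(_ (lshift s i)): (If m mf).
by rewrite /b (unsplitK (inl i)).
Qed.
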